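(* Let $X$ be a Banach space over $\mathbb{K}\in\{\mathbb{R},\mathbb{C}\}$, let $\tau$ be an admissible topology on $X$, and let $\{x_n\}_{n=0}^\infty\subseteq X$. Suppose that $f:\mathbb{N}\to\mathbb{N}$ is a function such that $|f^{-1}(\{n\})|<\infty$ for all $n\in\mathbb{N}$. If $\mathcal{T}\subseteq\mathbb{N}$ is infinite and satisfies $$\limsup_{n\to\infty,\;n\in\mathcal{T}}\Big\|\sum_{n_0\in f^{-1}(\{n\})}x_{n_0}\Big\|>0,$$ then, for $\mathbb{P}_{\mathrm{Haar}}$-almost all $\{\epsilon_n\}_{n=0}^\infty\in\{-1,+1\}^{\mathbb{N}}$, the formal series $$\sum_{n=0,\;f(n)\in\mathcal{T}}^\infty\epsilon_{f(n)}x_n\qquad\text{and}\qquad\sum_{n=0,\;f(n)\in\mathcal{T}}^\infty\frac12\big(1-\epsilon_{f(n)}\big)x_n$$ both fail to be $\tau$-summable.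
   Context: $\mathbb{N}=\{0,1,2,\dots\}$. A topology $\tau$ on a Banach space $X$ is called admissible if (1) it is a Hausdorff locally convex topological vector space topology on $X$, identical to or weaker than the norm topology, under which the norm-closed unit ball $\mathbb{B}=\{x\in X:\|x\|\le 1\}$ is $\tau$-closed; and (2) if $X$ is not separable, then $\tau$ is at least as strong as the weak topology of $X$. A formal series $\sum_{n=0}^\infty y_n$ with terms in $X$ is $\tau$-summable if its partial sums $\sum_{n=0}^N y_n$ converge in $(X,\tau)$ to an element of $X$ as $N\to\infty$. A sum restricted to indices with $f(n)\in\mathcal{T}$ is the formal series (in the original order) whose other terms are $0$. $\mathbb{P}_{\mathrm{Haar}}$ is the Haar probability measure on the Borel $\sigma$-algebra of the Cantor group $\{-1,+1\}^{\mathbb{N}}$ (product topology), i.e. the unique measure under which the coordinates $\epsilon_0,\epsilon_1,\dots$ are i.i.d. Rademacher random variables. A property holds for almost all points if it holds at every point of some measurable set of probability one (the set where the property holds is not itself required to be measurable). *)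

(* Defs.v *)
From HB Require Import structures.
From mathcomp Require Import all_boot all_order all_algebra.
From mathcomp Require Import complex.
From mathcomp Require Import all_classical all_reals all_analysis.

Set Implicit Arguments.
Unset Strict Implicit.
Unset Printing Implicit Defensive.

Import Order.TTheory GRing.Theory Num.Theory.
Import numFieldNormedType.Exports.

Local Open Scope classical_set_scope.
Local Open Scope ring_scope.

Variant scalar_field := RealField | ComplexField.

Definition scalars (R : realType) (k : scalar_field) : numFieldType :=
  match k with RealField => R | ComplexField => R[i] end.

Definition scalar_re (R : realType) (k : scalar_field) : scalars R k -> R :=
  match k return scalars R k -> R with
  | RealField => id
  | ComplexField => @complex.Re R
  end.

(* The norm of a normed module over K takes its values in K, where it is a
   nonnegative real scalar; [rnorm] is the same number seen in R. *)
Definition rnorm (R : realType) (k : scalar_field)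
    (X : normedModType (scalars R k)) (x : X) : R :=
  scalar_re `|x|.

Definition separable (T : topologicalType) : Prop :=
  exists2 S : set T, countable S & dense S.

Section weak_topology.
Variables (K : numFieldType) (X : normedModType K).

Definition dual_functional := {phi : {linear X -> K^o} | continuous phi}.

Definition weak_space : topologicalType :=
  sup_topology (fun phi : dual_functional =>
    Topological.class (initial_topology (sval phi : X -> K^o))).

End weak_topology.

(* A second topology on the carrier of X is a structure [tau : Topological X];
   [retop tau] is the carrier of X with that topology. *)
Definition retop (X : choiceType) (tau : Topological X) : topologicalType :=
  Topological.Pack tau.

Record admissible (K : numFieldType) (X : normedModType K)
    (tau : Topological X) : Prop := Admissible {
  admissible_hausdorff : hausdorff_space (retop tau) ;
  admissible_add :
    continuous ((fun z => (z.1 : X) + (z.2 : X)) :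
                  retop tau * retop tau -> retop tau) ;
  admissible_scale :
    continuous ((fun z => z.1 *: (z.2 : X)) :
                  K^o * retop tau -> retop tau) ;
  admissible_locally_convex :
    exists2 B : set_system (retop tau),
      (forall b, b \in B -> @convex_set K X b) & basis B ;
  admissible_weaker_than_norm :
    forall U : set X, @open (retop tau) U -> @open X U ;
  admissible_ball_closed :
    @closed (retop tau) [set x : X | `|x| <= 1] ;
  admissible_stronger_than_weak :
    ~ separable X ->
    forall U : set X, @open (weak_space X) U -> @open (retop tau) U
}.

Definition tau_summable (K : numFieldType) (X : normedModType K)
    (tau : Topological X) (y : nat -> X) : Prop :=
  exists l : X, series y @ \oo --> (l : retop tau).

(* The group {-1,+1}^N is encoded as N -> bool with pointwise xor; the n-th
   coordinate of e is the sign (-1)^(e n). *)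
Definition cantor_sign (K : numFieldType) (e : cantor_space) (n : nat) : K :=
  (-1) ^+ (e n).

Definition cantor_mul (g e : cantor_space) : cantor_space :=
  fun n => g n (+) e n.

Definition cantor_borel := g_sigma_algebraType (@open cantor_space).

Definition is_haar (R : realType) (P : probability cantor_borel R) : Prop :=
  forall (g : cantor_space) (A : set cantor_borel),
    measurable A -> P [set cantor_mul g e | e in A] = P A.

(* Main.v *)
Require Import Defs.
From HB Require Import structures.
From mathcomp Require Import all_boot all_order all_algebra.
From mathcomp Require Import complex.
From mathcomp Require Import all_classical all_reals all_analysis.
From mathcomp Require Import ring lra.

Set Implicit Arguments.
Unset Strict Implicit.
Unset Printing Implicit Defensive.

Import Order.TTheory GRing.Theory Num.Theory.
Import numFieldNormedType.Exports.

Local Open Scope classical_set_scope.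
Local Open Scope ring_scope.

(** Flipping a single sign e n with n in T changes all late partial sums of the
    random series by a fixed multiple, of modulus at least 1, of the block
    y n = \sum_(f m = n) x m, because that block is finite.  The hypothesis on
    the limit superior gives a delta > 0 such that delta < `|y n| for
    infinitely many n in T.  So a point e and its flip at such an n cannot both
    have their sums in one ball of radius delta / 2.

    For a measurable event A this is enough to make A null.  Indeed
    P (flip n @^-1` A `\` A) tends to 0 when A depends on finitely many signs,
    and, Haar measure being invariant under flips, this is inherited by
    complements and countable unions.  If A is disjoint from flip n @^-1` A for
    infinitely many n, then P (flip n @^-1` A `\` A) = P A for these n, so that
    P A = 0 ([flip_stable_null]).

    Two points remain.  The event that the series converges in tau to a point
    of the ball of centre d and radius delta / 2 need not be visibly
    measurable.  It is replaced by a larger event: for all n, eventually in N,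
    the N-th partial sum lies in d + ball + V n, where V n is a
    tau-neighbourhood of 0 so small that perturbing by it cannot bring the
    n-th jump back into the ball of radius delta.  Such a V n exists because
    balls are tau-closed.  The larger event is a countable combination of
    events depending on finitely many signs, and it still excludes pairs of
    points that differ by a flip ([random_series_null_near]).

    Finally, countably many centres d must account for all possible limits.
    In a separable space a dense sequence does.  Otherwise tau is finer than
    the weak topology, and the norm closure of the rational span of the x n
    contains the weak limits of its sequences: this is Hahn-Banach applied to
    the distance to that span ([weak_limit_near]). *)

(** * Flipping one sign under Haar measure *)

Definition flip (n : nat) (e : cantor_space) : cantor_space :=
  cantor_mul (fun i => i == n) e.

Lemma flip_eq n e : flip n e n = ~~ e n.
Proof. by rewrite /flip /cantor_mul eqxx addTb. Qed.

Lemma flip_neq n e i : i != n -> flip n e i = e i.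
Proof. by rewrite /flip /cantor_mul => /negPf ->; rewrite addFb. Qed.

Lemma flipK n : involutive (flip n).
Proof. by move=> e; apply/funext => i; rewrite /flip /cantor_mul addbA addbb. Qed.

Definition depends_below (m : nat) (A : set cantor_space) : Prop :=
  forall e e' : cantor_space, (forall i, (i < m)%N -> e i = e' i) -> A e -> A e'.

Lemma near_agree_below (m : nat) (e : cantor_space) :
  \forall e' \near e, forall i, (i < m)%N -> e i = e' i.
Proof.
elim: m => [|m IH]; first by apply: filterE.
have Hm : \forall e' \near e, e m = e' m.
  have := @proj_continuous nat (fun=> bool) m e.
  move=> /(_ [set b | e m = b]); apply.
  by rewrite nbhs_principalE; apply/principal_filterP.
near=> e' => i; rewrite ltnS leq_eqVlt => /orP[/eqP->|].
  by near: e'.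
by move: i; near: e'.
Unshelve. all: by end_near. Qed.

Lemma depends_below_measurable m (A : set cantor_borel) :
  depends_below m A -> measurable A.
Proof.
move=> mA; apply: sub_sigma_algebra; rewrite /= openE => e Ae.
by apply: filterS (near_agree_below m e) => e' /mA; apply.
Qed.

Section flip_stable.
Variables (R : realType) (P : probability cantor_borel R).
Hypothesis P_haar : is_haar P.
Local Open Scope ereal_scope.

Lemma haar_flip n (A : set cantor_borel) :
  measurable A -> P (flip n @^-1` A) = P A.
Proof.
move=> mA; rewrite -(P_haar (fun i => i == n) mA); congr (P _).
apply/seteqP; split=> [e Ae|_ [e Ae <-]] /=; last by rewrite -/(flip n e) flipK.
by exists (flip n e) => //; rewrite -/(flip n _) flipK.
Qed.

(** The events that one far-away sign hardly influences.  Unlike approximation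
    by cylinders, this form of the property can be tested directly against a
    flip. *)
Definition flip_stable (A : set cantor_borel) : Prop :=
  [/\ measurable A, forall n, measurable (flip n @^-1` A : set cantor_borel) &
      forall r : R, (0 < r)%R ->
        \forall n \near \oo, P ((flip n @^-1` A) `\` A) <= r%:E].

Lemma depends_below_flip_stable m A : depends_below m A -> flip_stable A.
Proof.
move=> mA.
have mflip n : depends_below m (flip n @^-1` A).
  move=> e e' ee'; apply: mA => i im.
  by rewrite /flip /cantor_mul (ee' _ im).
split=> [|n|r r0]; first exact: depends_below_measurable mA.
  exact: depends_below_measurable (mflip n).
exists m => // n /= mn.
rewrite (_ : _ `\` _ = set0) ?measure0 ?lee_fin 1?ltW//.
rewrite -subset0 => e [Ae]; apply; apply: mA Ae => i im.
by rewrite flip_neq// ltn_eqF// (leq_trans im).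
Qed.

(** Up to a flip, which preserves P, the sets flip n @^-1` A `\` A for A and
    for its complement coincide. *)
Lemma flip_stableC A : flip_stable A -> flip_stable (~` A).
Proof.
move=> [mA mfA sA]; split=> [|n|r /sA]; first exact: measurableC.
  by rewrite preimage_setC; apply: measurableC; exact: mfA.
apply: filterS => n; rewrite -(@haar_flip n (_ `\` A)); last exact: measurableD.
congr (P _ <= _); apply/seteqP; split=> e /=; rewrite flipK.
  by move=> [Ae nAf]; split.
by move=> [nAf nnA]; split=> //; exact: contrapT.
Qed.

Lemma flip_stableU A B : flip_stable A -> flip_stable B -> flip_stable (A `|` B).
Proof.
move=> [mA mfA sA] [mB mfB sB]; split=> [|n|r r0]; first exact: measurableU.
  by rewrite preimage_setU; apply: measurableU; [exact: mfA|exact: mfB].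
have r20 : (0 < r / 2)%R by rewrite divr_gt0.
near=> n; rewrite (splitr r) EFinD.
apply: (@le_trans _ _ (P ((flip n @^-1` A) `\` A) + P ((flip n @^-1` B) `\` B))).
  apply: (@le_trans _ _ (P (((flip n @^-1` A) `\` A) `|` ((flip n @^-1` B) `\` B)))).
    apply: le_measure; rewrite ?inE.
    - by apply: measurableD; [rewrite preimage_setU|]; apply: measurableU.
    - by apply: measurableU; exact: measurableD.
    - by move=> e [[?|?] nAB]; [left|right]; split=> // ?; apply: nAB; [left|right].
  by apply: measureU2; exact: measurableD.
by apply: leeD; near: n; [exact: sA|exact: sB].
Unshelve. all: by end_near. Qed.

(** A finite subunion B carries all but r / 2 of the measure, and what A gains
    from a flip comes either from B or from the flip of this remainder. *)
Lemma flip_stable_bigcup (F : nat -> set cantor_borel) :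
  (forall i, flip_stable (F i)) -> flip_stable (\bigcup_i F i).
Proof.
move=> sF; have mF i : measurable (F i) by case: (sF i).
have mU : measurable (\bigcup_i F i) by exact: bigcupT_measurable.
have mfU n : measurable (flip n @^-1` (\bigcup_i F i) : set cantor_borel).
  by rewrite preimage_bigcup; apply: bigcupT_measurable => i; case: (sF i).
split=> // r r0; have r20 : (0 < r / 2)%R by rewrite divr_gt0.
pose B m := \big[setU/set0]_(i < m) F i.
have sB m : flip_stable (B m).
  rewrite /B; elim/big_rec: _ => [|i A _ sA]; last exact: flip_stableU.
  exact: (@depends_below_flip_stable 0).
have mB m : measurable (B m) by case: (sB m).
have BU m : B m `<=` \bigcup_i F i.
  by rewrite /B -bigcup_mkord => e [i _ Fi]; exists i.
pose D m := (\bigcup_i F i) `\` B m.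
have mD m : measurable (D m) by exact: measurableD.
have PD0 : P \o D @ \oo --> 0.
  have -> : 0 = P (\bigcap_m D m).
    rewrite (_ : \bigcap_m D m = set0) ?measure0// -subset0 => e De.
    have [[i _ Fi] _] := De 0%N I.
    have [_] := De i.+1 I; apply; rewrite /B -bigcup_mkord; exists i => //=.
  apply: nonincreasing_cvg_mu => //.
  - by rewrite (le_lt_trans (probability_le1 _ _)) ?ltry.
  - exact: bigcapT_measurable.
  - apply/nonincreasing_seqP => m; apply/subsetPset => e [Ue nBe]; split=> //.
    by apply: contra_not nBe => Be; rewrite /B big_ord_recr/=; left.
have [m Dm] : exists m, P (D m) <= (r / 2)%:E.
  have : \forall m \near \oo, P (D m) < (r / 2)%:E.
    by apply: (PD0 [set y | y < (r / 2)%:E]); apply: open_ereal_lt'; rewrite lte_fin.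
  by case=> m _ /(_ m (leqnn m)) /ltW; exists m.
have [_ mfB sBm] := sB m.
near=> n; rewrite (splitr r) EFinD.
have mfD : measurable (flip n @^-1` D m : set cantor_borel).
  by apply: (measurableD (mfU n)); exact: mfB.
apply: (@le_trans _ _ (P ((flip n @^-1` B m) `\` B m) + P (flip n @^-1` D m))).
  apply: (@le_trans _ _ (P (((flip n @^-1` B m) `\` B m) `|` (flip n @^-1` D m)))).
    apply: le_measure; rewrite ?inE.
    - by apply: measurableD => //; exact: mfU.
    - by apply: measurableU => //; apply: measurableD => //; exact: mfB.
    - move=> e [Ue nUe]; have [Be|nBe] := pselect (B m (flip n e)); [left|right].
        by split=> // /BU.
      by split.
  by apply: measureU2 => //; apply: measurableD => //; exact: mfB.
by apply: leeD; [near: n; exact: sBm|rewrite haar_flip].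
Unshelve. all: by end_near. Qed.

Lemma flip_stable_bigcap (F : nat -> set cantor_borel) :
  (forall i, flip_stable (F i)) -> flip_stable (\bigcap_i F i).
Proof.
move=> sF; rewrite -[X in flip_stable X]setCK setC_bigcap.
by apply: flip_stableC; apply: flip_stable_bigcup => i; exact: flip_stableC.
Qed.

(** Disjointness makes flip n @^-1` A `\` A all of flip n @^-1` A, which has the
    measure of A. *)
Lemma flip_stable_null A : flip_stable A ->
  (forall m, exists2 n, (m <= n)%N & forall e, A e -> ~ A (flip n e)) ->
  P A = 0.
Proof.
move=> [mA mfA sA] dA; apply/eqP; rewrite eq_le measure_ge0 andbT.
apply/lee_addgt0Pr => r /sA [m _ Am]; rewrite add0e.
have [n mn dn] := dA m; rewrite -(haar_flip n mA); apply: le_trans (Am n mn).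
apply: le_measure; rewrite ?inE//; first exact: measurableD.
by move=> e Ae; split=> // /dn.
Qed.

End flip_stable.

(** * Limits in an admissible topology *)

Section admissible_translation.
Variables (K : numFieldType) (X : normedModType K) (tau : Topological X).
Hypothesis tau_adm : admissible tau.
Local Notation Xtau := (retop tau).

Lemma tau_cvgD (I : Type) (F : set_system I) (FF : Filter F) (u v : I -> X)
    (a b : X) :
  u @ F --> (a : Xtau) -> v @ F --> (b : Xtau) ->
  (fun i => u i + v i) @ F --> (a + b : Xtau).
Proof.
move=> ua vb; have := @admissible_add _ _ _ tau_adm (a, b).
exact: cvg_comp (cvg_pair ua vb).
Qed.

Lemma tau_cvgZ (I : Type) (F : set_system I) (FF : Filter F) (c : K) (u : I -> X)
    (a : X) :
  u @ F --> (a : Xtau) -> (fun i => c *: u i) @ F --> (c *: a : Xtau).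
Proof.
move=> ua; have ca : (fun i => ((c : K^o), (u i : Xtau))) @ F --> ((c : K^o), (a : Xtau)).
  have ca := @cvg_pair _ _ _ F (nbhs (c : K^o)) (nbhs (a : Xtau)) FF _ _ (fun=> c) u.
  apply: ca => //; exact: cvg_cst.
have cz := @admissible_scale _ _ _ tau_adm (c, a).
refine (cvg_comp _ _ ca cz).
Qed.

(** Closedness of the unit ball for tau, combined with continuity of the vector
    operations: two small perturbations do not bring a point from outside a
    ball into it. *)
Lemma tau_nbhs0_avoid_ball (r : K) (z : X) : 0 < r -> r < `|z| ->
  exists2 V : set X, nbhs (0 : Xtau) V &
    forall v w, V v -> V w -> ~ (`|z + v - w| <= r).
Proof.
move=> r0 rz.
pose h (p : Xtau * Xtau) : X := r^-1 *: ((z + p.1) + (-1) *: (p.2 : X)).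
have hc : h @ (nbhs ((0 : Xtau), (0 : Xtau))) --> (r^-1 *: ((z + 0) + (-1) *: 0) : Xtau).
  apply: tau_cvgZ; apply: tau_cvgD; last by apply: tau_cvgZ; exact: cvg_snd.
  by apply: tau_cvgD; [exact: (@cvg_cst Xtau)|exact: cvg_fst].
have norm_h v w : `|h (v, w)| <= 1 <-> `|z + v - w| <= r.
  rewrite /h/= scaleN1r normrZ gtr0_norm ?invr_gt0// mulrC ler_pdivrMr// mul1r.
  by [].
have /hc : nbhs (r^-1 *: ((z + 0) + (-1) *: 0) : Xtau) (~` [set x : X | `|x| <= 1]).
  apply: open_nbhs_nbhs; split.
    by rewrite openC; exact: admissible_ball_closed tau_adm.
  rewrite /= -/(h (0, 0)) norm_h addr0 subr0; apply/negP.
  by rewrite (lt_geF rz).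
move=> [[V W] /= [nV nW] VW].
exists (V `&` W); first exact: filterI.
by move=> v w [Vv _] [_ Ww]; rewrite -norm_h; exact: (VW (v, w)).
Qed.

Lemma tau_cvg_near (u : nat -> X) (l : X) (V : set X) :
  u @ \oo --> (l : Xtau) -> nbhs (0 : Xtau) V ->
  \forall N \near \oo, V (u N - l).
Proof.
move=> ul nV.
have : (fun N => u N - l) @ \oo --> (l - l : Xtau).
  by apply: tau_cvgD => //; exact: (@cvg_cst Xtau).
by rewrite subrr; apply.
Qed.

End admissible_translation.

(** * Random series with large blocks *)

Section random_series.
Variables (R : realType) (P : probability cantor_borel R).
Hypothesis P_haar : is_haar P.
Variables (K : numFieldType) (X : normedModType K) (tau : Topological X).
Hypothesis tau_adm : admissible tau.
Variables (x : nat -> X) (f : nat -> nat) (T : set nat).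
Hypothesis f_fin : forall n, finite_set (f @^-1` [set n]).
(* The coefficient as a function of the sign bit: (-1) ^+ b for the first series
   of the theorem and (1 - (-1) ^+ b) / 2 for the second. *)
Variable a : bool -> K.

Definition block n : X := \sum_(m \in f @^-1` [set n]) x m.

Definition random_term (e : cantor_space) : nat -> X :=
  patch (fun=> 0) (f @^-1` T) (fun n => a (e (f n)) *: x n).

Lemma random_partial_depends N (Z : set X) : exists m,
  depends_below m [set e | Z (series (random_term e) N)].
Proof.
(* any bound that exceeds f i for all i < N *)
exists (\sum_(i < N) (f i).+1)%N => e e' ee' /=.
congr Z; apply: eq_big_nat => i /andP[_ iN].
rewrite /random_term /patch; case: ifP => // _; rewrite ee'//.
by rewrite (bigD1 (Ordinal iN))//= addSn ltnS leq_addr.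
Qed.

Lemma random_partial_flip n : T n -> exists m, forall N, (m <= N)%N ->
  forall e, series (random_term e) N - series (random_term (flip n e)) N =
    (a (e n) - a (~~ e n)) *: block n.
Proof.
move=> Tn; have [m mP] : exists m, forall i, f i = n -> (i < m)%N.
  have [s sP] := (finite_seqP _).1 (f_fin n).
  exists (\max_(i <- s) i).+1 => i fi; rewrite ltnS.
  have /= is_ : [set` s] i by rewrite -sP.
  exact: leq_bigmax_seq.
exists m => N mN e; rewrite /series/= -sumrB.
have -> : block n = \sum_(0 <= i < N | f i == n) x i.
  rewrite -big_filter fsbig_seq ?filter_uniq ?iota_uniq// /block.
  congr (\sum_(i \in _) _); apply/seteqP; split=> [i /= fin|i /=].
    by rewrite mem_filter fin eqxx mem_index_iota/= (leq_trans (mP _ fin)).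
  by rewrite mem_filter => /andP[/eqP].
rewrite scaler_sumr big_mkcond [RHS]big_mkcond; apply: eq_bigr => i _.
rewrite /random_term /patch; case: ifPn => [|/negP fT]; rewrite ?inE.
  case: eqVneq => [-> _|fin _]; first by rewrite flip_eq scalerBl.
  by rewrite flip_neq// subrr.
rewrite subr0; case: eqVneq => // fin; case: fT; rewrite inE /= fin; exact: Tn.
Qed.

Variables (delta : K).
Hypothesis delta_gt0 : 0 < delta.
Hypothesis large_blocks :
  forall m, exists n, [/\ (m <= n)%N, T n & delta < `|block n|].
Hypothesis a_gap : 1 <= `|a true - a false|.

Let gap n : X := (a true - a false) *: block n.

(** The event is covered by A, whose definition only involves partial sums.  If
    e and flip n e both lie in A, comparing late partial sums writes the jump
    of size at least `|block n| > delta as b1 - b2 plus two errors from V n,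
    with b1 and b2 in the ball of radius delta / 2; the choice of V n forbids
    this. *)
Lemma random_series_null_near (d : X) :
  P.-negligible [set e | exists2 l : X,
    series (random_term e) @ \oo --> (l : retop tau) & `|l - d| <= delta / 2].
Proof.
have [V VP] : {V : nat -> set X & forall n, nbhs (0 : retop tau) (V n) /\
    (delta < `|block n| -> forall v w, V n v -> V n w -> ~ `|gap n + v - w| <= delta)}.
  apply: (@choice _ _ (fun n (Vn : set X) => nbhs (0 : retop tau) Vn /\
    (delta < `|block n| ->
      forall v w, Vn v -> Vn w -> ~ `|gap n + v - w| <= delta))) => n.
  have [dn|ndn] := pselect (delta < `|block n|); last first.
    by exists setT; split; [exact: filterT|].
  have [|Vn ? ?] := @tau_nbhs0_avoid_ball _ _ _ tau_adm _ (gap n) delta_gt0.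
    by rewrite /gap normrZ (lt_le_trans dn)// ler_peMl.
  by exists Vn.
pose Z n : set X := [set z | exists2 b, `|b| <= delta / 2 & V n (z - d - b)].
pose A : set cantor_borel := \bigcap_n \bigcup_m \bigcap_i
  [set e | Z n (series (random_term e) (m + i)%N)].
have sA : flip_stable P A.
  apply: flip_stable_bigcap => // n; apply: flip_stable_bigcup => // m.
  apply: flip_stable_bigcap => // i.
  have [q qP] := random_partial_depends (m + i)%N (Z n).
  exact: depends_below_flip_stable qP.
exists A; split; first by case: sA.
  apply: flip_stable_null => // m; have [n [mn Tn dn]] := large_blocks m.
  exists n => //.
  (* Either e or flip n e has the bit n set, which fixes the sign of the jump. *)
  suff main (e : cantor_space) : e n -> A e -> A (flip n e) -> False.
    move=> e Ae Afe; have [en|nen] := boolP (e n); first exact: main en Ae Afe.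
    by apply: (main (flip n e)); rewrite ?flipK// flip_eq.
  move=> en /(_ n I)[m1 _ A1] /(_ n I)[m2 _ A2].
  have [m3 H3] := random_partial_flip Tn.
  pose N := maxn m3 (maxn m1 m2).
  have [b1 b1d V1] : Z n (series (random_term e) N).
    have := A1 (N - m1)%N I; rewrite /= subnKC//.
    by rewrite !leq_max leqnn !orbT.
  have [b2 b2d V2] : Z n (series (random_term (flip n e)) N).
    have := A2 (N - m2)%N I; rewrite /= subnKC//.
    by rewrite !leq_max leqnn !orbT.
  apply: ((VP n).2 dn _ _ V2 V1).
  have := H3 N (leq_maxl _ _) e; rewrite en /= -/(gap n) => <-.
  set s := series _ N; set t := series _ N.
  have -> : s - t + (t - d - b2) - (s - d - b1) = b1 - b2.
    by rewrite !addrA subrK; set w := s - d; rewrite opprB [LHS]addrC addrA subrK.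
  by rewrite (splitr delta) (le_trans (ler_normB _ _))// lerD.
move=> e [l el ld] n _.
have := tau_cvg_near tau_adm el (VP n).1.
move=> [m _ mP]; exists m => // i _ /=; exists (l - d) => //.
have := mP (m + i)%N (leq_addr _ _) => /=.
by rewrite opprB addrA subrK.
Qed.

Lemma random_series_null (D : set X) : countable D ->
  (forall e l, series (random_term e) @ \oo --> (l : retop tau) ->
    exists2 d, D d & `|l - d| <= delta / 2) ->
  P.-negligible [set e | tau_summable tau (random_term e)].
Proof.
move=> cD Dcover.
have [D0|[g]] := pfcard_geP cD.
  apply: negligibleS (@negligible_set0 _ _ _ P) => e [l /Dcover[d]].
  by rewrite D0.
apply: negligibleS (negligible_bigcup (fun i => random_series_null_near (g i))).
move=> e [l el]; have [d /(@surj _ _ _ _ g)[i _ <-] ld] := Dcover _ _ el.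
by exists i => //; exists l.
Qed.

End random_series.

(** * Hahn-Banach by minimal sublinear functions *)

Section additive_hahn_banach.
Variables (R : realType) (V : zmodType).
Implicit Types (p q : V -> R).

(** Homogeneity is asked for natural multiples only: that suffices to produce
    additive minorants on an abelian group, and the same statement then serves
    real and complex spaces. *)
Definition sublinear q : Prop :=
  (forall x y, q (x + y) <= q x + q y) /\
  (forall n x, n%:R * q x <= q (x *+ n)).

Lemma sublinear0 q : sublinear q -> q 0 = 0.
Proof.
move=> [_ hq]; apply/eqP; rewrite eq_le; apply/andP; split.
  by have := hq 2%N 0; rewrite mul0rn mulr_natl mulr2n gerDl.
by have := hq 0%N 0; rewrite mul0r mulr0n.
Qed.

Lemma sublinear_ge q p x : sublinear q -> (forall z, q z <= p z) ->
  - p (- x) <= q x.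
Proof.
move=> sq qp; rewrite lerNl -subr_ge0 opprK.
apply: le_trans (_ : q (- x) + q x <= _); last by rewrite lerD2r.
by rewrite -(sublinear0 sq) -[in X in X <= _](addNr x); exact: sq.1.
Qed.

Lemma sublinearMn q n x : sublinear q -> q (x *+ n) <= n%:R * q x.
Proof.
move=> sq; elim: n => [|n IH]; first by rewrite mulr0n mul0r (sublinear0 sq).
by rewrite mulrS (le_trans (sq.1 _ _))// -nat1r mulrDl mul1r lerD2l.
Qed.

(** A sublinear minorant of q whose value at - y is at most - q y.  If q is
    minimal, it must be q itself, which makes q additive in the direction y. *)
Definition inf_along q y x : R := inf [set q (x + y *+ n) - n%:R * q y | n in setT].

Lemma inf_along_le q y n x : sublinear q ->
  inf_along q y x <= q (x + y *+ n) - n%:R * q y.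
Proof.
move=> sq; apply: ge_inf; last by exists n.
exists (- q (- x)) => _ [m _ <-].
rewrite lerBrDr addrC lerBlDr (le_trans (sq.2 m y))//.
by rewrite -[in X in X <= _](addKr x (y *+ m)) addrC sq.1.
Qed.

Lemma inf_along_ge q y x r : (forall n, r <= q (x + y *+ n) - n%:R * q y) ->
  r <= inf_along q y x.
Proof.
move=> rq; apply: lb_le_inf; first by exists (q (x + y *+ 0) - 0%:R * q y), 0%N.
by move=> _ [n _ <-].
Qed.

Lemma inf_along_sublinear q y : sublinear q -> sublinear (inf_along q y).
Proof.
move=> sq; split=> [x x'|m x].
  rewrite -lerBlDr; apply: inf_along_ge => n; rewrite lerBlDr -lerBlDl.
  apply: inf_along_ge => m; rewrite lerBlDl.
  apply: le_trans (inf_along_le y (n + m) (x + x') sq) _.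
  rewrite mulrnDr [X in q X]addrACA natrD mulrDl opprD [leRHS]addrACA lerD2r.
  exact: sq.1.
apply: inf_along_ge => n; rewrite lerBrDr.
apply: (@le_trans _ _ (m%:R * q (x + y *+ n) - m%:R * (n%:R * q y) + n%:R * q y)).
  by rewrite lerD2r -mulrBr ler_wpM2l// inf_along_le.
case: m => [|m]; first by rewrite !mul0r subrr add0r mulr0n add0r sq.2.
have le1 : m.+1%:R * q (x + y *+ n) <= q (x *+ m.+1 + y *+ n) + q (y *+ (m * n)).
  apply: le_trans (sq.2 _ _) _; apply: le_trans (sq.1 _ _).
  by rewrite -addrA -mulrnDr -mulSn mulrnDl mulrnA mulrnAC.
have le2 := sublinearMn (m * n) y sq.
rewrite natrM -nat1r in le1 le2 *; lra.
Qed.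

(** Zorn: the pointwise infimum of a chain is finite since each member is
    bounded below by - p (- x), and subadditive since two members of a chain
    are comparable. *)
Lemma minimal_sublinear p : sublinear p ->
  exists q, [/\ sublinear q, forall x, q x <= p x &
    forall q', sublinear q' -> (forall x, q' x <= q x) -> q' = q].
Proof.
move=> sp.
pose M := {q : V -> R | sublinear q /\ forall x, q x <= p x}.
have [||||[q [sq qp]] qmin] :=
    @Zorn M (fun q q' : M => `[< forall x, sval q' x <= sval q x >]).
- by move=> q; apply/asboolP.
- move=> q1 q2 q3 /asboolP q12 /asboolP q23; apply/asboolP => x.
  exact: le_trans (q23 x) (q12 x).
- move=> [q1 Hq1] [q2 Hq2] /asboolP/= q12 /asboolP/= q21.
  apply: eq_exist; apply/funext => x; apply/eqP.
  by rewrite eq_le q12 q21.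
- move=> A Atot; have [->|/set0P[q0 Aq0]] := eqVneq A set0.
    by exists (exist _ p (conj sp (fun x => lexx (p x)))).
  pose t x := inf [set sval (q : M) x | q in A].
  have t_le (q : M) x : A q -> t x <= sval q x.
    move=> Aq; apply: ge_inf; last by exists q.
    exists (- p (- x)) => _ [[q' [sq' q'p]] _ <-] /=; exact: sublinear_ge.
  have t_ge r x : (forall q : M, A q -> r <= sval q x) -> r <= t x.
    move=> rA; apply: lb_le_inf; first by exists (sval q0 x), q0.
    by move=> _ [q Aq <-]; exact: rA.
  have tp x : t x <= p x by apply: le_trans (t_le _ x Aq0) _; exact: (svalP q0).2.
  have st : sublinear t.
    split=> [x y|n x].
      rewrite -lerBlDr; apply: (t_ge _ x) => q Aq; rewrite lerBlDr -lerBlDl.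
      apply: (t_ge _ y) => q' Aq'; rewrite lerBlDl.
      have [/asboolP qq'|/asboolP qq'] := Atot _ _ Aq Aq'.
        apply: le_trans (t_le _ _ Aq') _; apply: le_trans ((svalP q').1.1 x y) _.
        by rewrite lerD2r.
      apply: le_trans (t_le _ _ Aq) _; apply: le_trans ((svalP q).1.1 x y) _.
      by rewrite lerD2l.
    apply: (t_ge _ (x *+ n)) => q Aq; apply: le_trans ((svalP q).1.2 n x).
    by rewrite ler_wpM2l// t_le.
  exists (exist _ t (conj st tp)) => q Aq; apply/asboolP => x /=; exact: t_le.
exists q; split=> // q' sq' q'q.
have q'p x : q' x <= p x by exact: le_trans (q'q x) (qp x).
by have /(congr1 sval) := qmin (exist _ q' (conj sq' q'p)) (asboolT q'q).
Qed.

(** Starting the search for a minimal function below inf_along p l instead of p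
    forces the value at l. *)
Theorem additive_hahn_banach p l : sublinear p ->
  exists g : V -> R,
    [/\ forall x y, g (x + y) = g x + g y, forall x, g x <= p x & p l <= g l].
Proof.
move=> sp; have [g [sg gp gmin]] := minimal_sublinear (inf_along_sublinear l sp).
have gD x y : g (x + y) = g x + g y.
  apply/eqP; rewrite eq_le sg.1/=.
  rewrite -lerBrDr -[in X in X <= _](gmin (inf_along g y)).
  - by have := inf_along_le y 1 x sg; rewrite mulr1n mul1r.
  - exact: inf_along_sublinear.
  - by move=> z; have := inf_along_le y 0 z sg; rewrite mulr0n addr0 mul0r subr0.
exists g; split=> // [x|].
  apply: le_trans (gp x) _.
  by have := inf_along_le l 0 x sp; rewrite mulr0n addr0 mul0r subr0.
rewrite -[leRHS]opprK lerNr.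
have -> : - g l = g (- l).
  by apply/eqP; rewrite eq_sym -addr_eq0 -gD addNr (sublinear0 sg).
apply: le_trans (gp _) _; have := inf_along_le l 1 (- l) sp.
by rewrite mulr1n addNr (sublinear0 sp) mul1r add0r.
Qed.

End additive_hahn_banach.

(** * Real parts and real norms *)

Section real_part.
Variables (R : realType) (k : scalar_field).
Implicit Types (a b : scalars R k).

Definition real_scalar (r : R) : scalars R k :=
  match k return scalars R k with RealField => r | ComplexField => real_complex R r end.

Lemma real_scalarK r : scalar_re (real_scalar r) = r.
Proof. by rewrite /real_scalar; case: k. Qed.

Lemma scalar_reD a b : scalar_re (a + b) = scalar_re a + scalar_re b.
Proof. by case: k a b => // -[? ?] [? ?]. Qed.

Lemma scalar_reMn a n : scalar_re (a *+ n) = scalar_re a *+ n.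
Proof.
elim: n => [|n IH]; last by rewrite !mulrS scalar_reD IH.
by rewrite !mulr0n; case: (k).
Qed.

Lemma ler_real_scalar r s : (real_scalar r <= real_scalar s) = (r <= s).
Proof. by rewrite /real_scalar; case: k => //; rewrite lecR. Qed.

Lemma ltr_real_scalar r s : (real_scalar r < real_scalar s) = (r < s).
Proof. by rewrite /real_scalar; case: k => //; rewrite ltcR. Qed.

Lemma real_scalar0 : real_scalar 0 = 0.
Proof. by rewrite /real_scalar; case: k. Qed.

Lemma real_scalar1 : real_scalar 1 = 1.
Proof. by rewrite /real_scalar; case: k. Qed.

Lemma real_scalarD r s : real_scalar (r + s) = real_scalar r + real_scalar s.
Proof. by rewrite /real_scalar; case: k => //; rewrite rmorphD. Qed.

Lemma scalar_re_nneg a : 0 <= a -> a = real_scalar (scalar_re a).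
Proof.
by rewrite /real_scalar; case: k a => //= -[u v]; rewrite lecE /= => /andP[/eqP->].
Qed.

Lemma scalar_re_le_norm a : real_scalar `|scalar_re a| <= `|a|.
Proof. by rewrite /real_scalar; case: k a => //= a; exact: normc_ge_Re. Qed.

Lemma scalar_re_gt0_open : open [set a : (scalars R k)^o | 0 < scalar_re a].
Proof.
rewrite openE => a /= a0; apply/nbhs_ballP; exists (real_scalar (scalar_re a)).
  by rewrite /= -real_scalar0 ltr_real_scalar.
move=> b; rewrite -ball_normE /= => ab.
have := le_lt_trans (scalar_re_le_norm (a - b)) ab; rewrite ltr_real_scalar.
move=> /(le_lt_trans (ler_norm _)).
have -> : scalar_re (a - b) = scalar_re a - scalar_re b.
  by apply/eqP; rewrite eq_sym subr_eq -scalar_reD subrK.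
by rewrite gtrBl.
Qed.

Variable X : normedModType (scalars R k).
Implicit Types x y : X.

Lemma norm_rnorm x : `|x| = real_scalar (rnorm x).
Proof. exact: scalar_re_nneg. Qed.

Lemma rnorm_ge0 x : 0 <= rnorm x.
Proof. by rewrite -ler_real_scalar -norm_rnorm real_scalar0. Qed.

Lemma rnormN x : rnorm (- x) = rnorm x.
Proof. by rewrite /rnorm normrN. Qed.

Lemma rnormD x y : rnorm (x + y) <= rnorm x + rnorm y.
Proof.
rewrite -scalar_reD -ler_real_scalar -norm_rnorm.
by rewrite -scalar_re_nneg ?ler_normD ?addr_ge0.
Qed.

Lemma rnormMn x n : rnorm (x *+ n) = rnorm x *+ n.
Proof. by rewrite /rnorm normrMn scalar_reMn. Qed.

Lemma rnorm_real_scalar r x : rnorm (real_scalar r *: x) = `|r| * rnorm x.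
Proof.
rewrite /rnorm normrZ /real_scalar; case: k X x => //= Y y.
rewrite [`|real_complex R r|]normc_def /= expr0n addr0 sqrtr_sqr.
by case: `|y| => u v /=; rewrite mul0r subr0.
Qed.

End real_part.

(** The defect d r = h r - r * h 1 is additive and vanishes on the integers,
    so each d (r *+ n) = d r *+ n is a value of d on [0, 1[, where d is bounded. *)
Lemma additive_bounded_linear (R : realType) (h : R -> R) (C : R) :
  (forall r s, h (r + s) = h r + h s) -> (forall r, `|h r| <= C * `|r|) ->
  forall r, h r = r * h 1.
Proof.
move=> hD hC r.
pose d s := h s - s * h 1.
have dD s t : d (s + t) = d s + d t by rewrite /d hD; ring.
have d0 : d 0 = 0 by rewrite -[LHS](addrK (d 0)) -dD addr0 subrr.
have dN s : d (- s) = - d s by apply/eqP; rewrite -addr_eq0 -dD addNr d0.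
have dMn s n : d (s *+ n) = d s *+ n.
  by elim: n => [|n IH]; rewrite ?mulr0n// !mulrS dD IH.
have d1 : d 1 = 0 by rewrite /d mul1r subrr.
have dZ (z : int) : d z%:~R = 0.
  by case: z => n; rewrite ?NegzE ?rmorphN ?dN /= -pmulrn dMn d1 mul0rn ?oppr0.
have dle s : `|s| <= 1 -> `|d s| <= C + `|h 1|.
  move=> s1; rewrite /d (le_trans (ler_normB _ _))// lerD//.
    rewrite (le_trans (hC s))// -[leRHS]mulr1 ler_wpM2l//.
    by have := le_trans (normr_ge0 _) (hC 1); rewrite normr1 mulr1.
  by rewrite normrM ler_piMl.
have dn n : `|d r| *+ n <= C + `|h 1|.
  rewrite -normrMn -dMn -[X in d X](subrK (Num.floor (r *+ n))%:~R) dD dZ addr0.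
  by rewrite dle// ger0_norm ?subr_ge0 ?floor_le// lerBlDr addrC -intrD1 ltW ?floorD1_gt.
apply/eqP; rewrite -subr_eq0 -/(d r) -normr_le0 leNgt; apply/negP => dr0.
have M0 : 0 <= C + `|h 1| by have := dn 0%N; rewrite mulr0n.
have := archi_boundP (divr_ge0 M0 (ltW dr0)); rewrite ltr_pdivrMr//.
by rewrite mulr_natl ltNge dn.
Qed.

Lemma additive_bounded_continuous (K : numFieldType) (X : normedModType K)
    (phi : X -> K^o) :
  (forall x y, phi (x - y) = phi x - phi y) ->
  (forall x, `|phi x| <= `|x| + `|x|) -> continuous phi.
Proof.
move=> phiB phi_le x; apply/cvgrPdist_lt => e e0; near=> y.
rewrite -phiB (le_lt_trans (phi_le _))// (splitr e).
have xy : `|x - y| < e / 2.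
  by near: y; apply: (@cvgr_dist_lt _ _ _ (nbhs x) _ id x) => //; rewrite divr_gt0.
exact: ltrD.
Unshelve. all: by end_near. Qed.

(** Over the complex numbers, phi x = g x - i g (i x). *)
Lemma extend_scalars (R : realType) (k : scalar_field)
    (X : normedModType (scalars R k)) (g : X -> R) :
  (forall x y, g (x + y) = g x + g y) -> (forall x, `|g x| <= rnorm x) ->
  exists2 phi : {linear X -> (scalars R k)^o},
    continuous phi & forall x, scalar_re (phi x) = g x.
Proof.
move=> gD g_le.
have gZ r x : g (real_scalar k r *: x) = r * g x.
  rewrite (@additive_bounded_linear _ (fun r => g (real_scalar k r *: x)) (rnorm x)).
  - by rewrite real_scalar1 scale1r.
  - move=> s t; rewrite -gD -scalerDl real_scalarD; reflexivity.
  - by move=> s; rewrite (le_trans (g_le _))// rnorm_real_scalar mulrC.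
have g0 : g 0 = 0 by rewrite -[LHS](addrK (g 0)) -gD addr0 subrr.
have gN x : g (- x) = - g x by apply/eqP; rewrite -addr_eq0 -gD addNr g0.
clear g0; case: k X g gD g_le gZ gN => X g gD g_le gZ gN.
  have glin : linear (g : X -> R^o) by move=> r x y; rewrite gD gZ.
  pose phi : {linear X -> R^o} :=
    HB.pack (g : X -> R^o) (GRing.isLinear.Build _ _ _ _ _ glin).
  exists phi => //; apply: additive_bounded_continuous => [x y|x].
    by rewrite raddfB.
  by rewrite (le_trans (g_le x))// lerDl.
pose f (x : X) : (R[i])^o := real_complex R (g x) - 'i%C * real_complex R (g ('i%C *: x)).
have gZ' (r : R) (x : X) : g (real_complex R r *: x) = r * g x := gZ r x.
have flin : linear f.
  move=> a x y; rewrite /f; case: a => u v.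
  have -> : (u +i* v)%C = real_complex R u + 'i%C * real_complex R v :> R[i].
    by rewrite [LHS]complexE.
  have -> : 'i%C *: ((real_complex R u + 'i%C * real_complex R v) *: x + y) =
      real_complex R u *: ('i%C *: x) + real_complex R v *: - x + 'i%C *: y.
    rewrite scalerDr !scalerA; congr (_ + _).
    rewrite scalerN -scaleNr -scalerDl mulrDr mulrA -expr2 sqr_i mulN1r.
    by rewrite [_ * real_complex R u]mulrC.
  have -> : (real_complex R u + 'i%C * real_complex R v) *: x =
      real_complex R u *: x + real_complex R v *: ('i%C *: x).
    by rewrite scalerDl scalerA ['i%C * _]mulrC.
  rewrite !gD !gZ' gN !rmorphD !rmorphM rmorphN /=.
  have i2 : 'i%C * 'i%C = -1 :> R[i] by rewrite -expr2 sqr_i.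
  rewrite /GRing.scale/=.
  set U := real_complex R u; set W := real_complex R v.
  set gx := real_complex R (g x); set gix := real_complex R (g ('i%C *: x)).
  set gy := real_complex R (g y); set giy := real_complex R (g ('i%C *: y)).
  apply/eqP; rewrite -subr_eq0; apply/eqP.
  transitivity (W * gix * ('i%C * 'i%C + 1)); last by rewrite i2 addNr mulr0.
  ring.
pose phi : {linear X -> (R[i])^o} :=
  HB.pack f (GRing.isLinear.Build _ _ _ _ _ flin).
have gle x : `|real_complex R (g x)| <= `|x|.
  rewrite (norm_rnorm (k := ComplexField)) /= [`|real_complex R _|]normc_def /=.
  by rewrite expr0n addr0 sqrtr_sqr lecR.
have ni : `|'i%C : R[i]| = 1 by rewrite complexiE normCi.
exists phi => [|x].
  apply: additive_bounded_continuous => [x y|x]; first by rewrite raddfB.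
  apply: le_trans (ler_normB _ _) _; apply: lerD => //.
  rewrite normrM ni mul1r; apply: le_trans (gle _) _.
  by rewrite normrZ ni mul1r.
by rewrite /phi /= /f /=; ring.
Qed.

(** * Weak limits lie in the norm closure *)

Section norm_separation.
Variables (R : realType) (k : scalar_field) (X : normedModType (scalars R k)).
(* D is a subspace over the rationals, such as a countable rational span. *)
Variable D : set X.
Hypothesis D_nonempty : D !=set0.
Hypothesis D_add : forall d d', D d -> D d' -> D (d + d').
Hypothesis D_opp : forall d, D d -> D (- d).
Hypothesis D_div : forall n d, D d -> exists2 d', D d' & d = d' *+ n.+1.

Definition distance (x : X) : R := inf [set rnorm (x - d) | d in D].

Lemma distance_le x d : D d -> distance x <= rnorm (x - d).
Proof.
move=> Dd; apply: ge_inf; last by exists d.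
by exists 0 => _ [d' _ <-]; exact: rnorm_ge0.
Qed.

Lemma distance_ge x r : (forall d, D d -> r <= rnorm (x - d)) -> r <= distance x.
Proof.
move=> rD; have [d0 Dd0] := D_nonempty.
apply: lb_le_inf; first by exists (rnorm (x - d0)), d0.
by move=> _ [d Dd <-]; exact: rD.
Qed.

Lemma distance_sublinear : sublinear distance.
Proof.
split=> [x y|[|n] x].
- rewrite -lerBlDr; apply: distance_ge => d Dd; rewrite lerBlDr -lerBlDl.
  apply: distance_ge => d' Dd'; rewrite lerBlDl.
  apply: le_trans (distance_le _ (D_add Dd Dd')) _.
  by rewrite opprD addrACA rnormD.
- by rewrite mul0r; apply: distance_ge => d _; exact: rnorm_ge0.
- apply: distance_ge => d /(D_div n)[d' Dd' ->].
  by rewrite -mulrnBl rnormMn -[leRHS]mulr_natl ler_wpM2l// distance_le.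
Qed.

(** The distance to D is sublinear, at most 0 on D and at most the norm, hence
    so is any additive g below it: g vanishes on D and is norm bounded. *)
Lemma norm_separation (l : X) (eta : R) : 0 < eta ->
  (forall d, D d -> eta <= rnorm (l - d)) ->
  exists phi : {linear X -> (scalars R k)^o},
    [/\ continuous phi, forall d, D d -> scalar_re (phi d) = 0 &
        0 < scalar_re (phi l)].
Proof.
move=> eta0 l_far.
have D0 : D 0 by have [d Dd] := D_nonempty; rewrite -(subrr d); exact/D_add/D_opp.
have [g [gD g_le gl]] := additive_hahn_banach l distance_sublinear.
have g0 : g 0 = 0 by rewrite -[LHS](addrK (g 0)) -gD addr0 subrr.
have gN x : g (- x) = - g x by apply/eqP; rewrite -addr_eq0 -gD addNr g0.
have g_rnorm x : g x <= rnorm x.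
  by rewrite (le_trans (g_le x))// (le_trans (distance_le x D0))// subr0.
have gle x : `|g x| <= rnorm x.
  by rewrite ler_norml g_rnorm andbT lerNl -gN -(rnormN x) g_rnorm.
have gD_le0 d : D d -> g d <= 0.
  move=> Dd; apply: le_trans (g_le d) _; apply: le_trans (distance_le d Dd) _.
  by rewrite subrr /rnorm normr0 -real_scalar0 real_scalarK.
have [phi phi_cont phiE] := extend_scalars gD gle.
exists phi; split=> // [d Dd|]; rewrite phiE.
  by apply/eqP; rewrite eq_le gD_le0//= -oppr_le0 -gN gD_le0//; exact: D_opp.
by rewrite (lt_le_trans eta0)// (le_trans _ gl)// distance_ge.
Qed.

(** A functional with real part 0 on D and positive at l gives a weak, hence
    tau-, neighbourhood of l that misses the sequence. *)
Lemma weak_limit_near (tau : Topological X) (u : nat -> X) (l : X) (eta : R) :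
  (forall U : set X, @open (weak_space X) U -> @open (retop tau) U) ->
  (forall N, D (u N)) -> u @ \oo --> (l : retop tau) -> 0 < eta ->
  exists2 d, D d & rnorm (l - d) < eta.
Proof.
move=> weak_tau Du ul eta0; apply: contrapT => far.
have l_far d : D d -> eta <= rnorm (l - d).
  by move=> Dd; rewrite leNgt; apply/negP => ld; apply: far; exists d.
have [phi [phi_cont phiD phil]] := norm_separation eta0 l_far.
pose U : set X := [set z | 0 < scalar_re (phi z)].
pose phi' : dual_functional X := exist _ phi phi_cont.
have oU : @open (weak_space X) U.
  rewrite openE => z Uz.
  have /cvg_sup/(_ phi') := @cvg_id (weak_space X) (nbhs z).
  move=> /(_ U); apply; apply: open_nbhs_nbhs; split => //.
  exists [set a | 0 < scalar_re a] => //; exact: scalar_re_gt0_open.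
have : nbhs (l : retop tau) U by apply: open_nbhs_nbhs; split=> //; exact: weak_tau.
by move=> /ul[N _ /(_ N (leqnn N))]; rewrite /= /U /= phiD// ltxx.
Qed.

End norm_separation.

Section rational_span.
Variables (K : numFieldType) (X : lmodType K) (x : nat -> X).

(** Polynomials serve as finitely supported coefficient sequences: they are
    countable and already form a rational vector space. *)
Definition rational_combination (p : {poly rat}) : X :=
  \sum_(i < size p) ratr p`_i *: x i.

Definition rational_span : set X := range rational_combination.

Lemma rational_combination_widen (p : {poly rat}) N : (size p <= N)%N ->
  rational_combination p = \sum_(i < N) ratr p`_i *: x i.
Proof.
move=> pN; rewrite /rational_combination (big_ord_widen _ (fun i => ratr p`_i *: x i) pN).
rewrite [RHS](bigID (fun i : 'I_N => (i < size p)%N))/= [X in _ + X]big1 ?addr0// => i.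
by rewrite -leqNgt => pi; rewrite nth_default// raddf0 scale0r.
Qed.

Lemma rational_span_poly N (c : nat -> rat) :
  rational_span (\sum_(0 <= i < N) ratr (c i) *: x i).
Proof.
exists (\poly_(i < N) c i) => //.
rewrite (rational_combination_widen (size_poly _ _)) big_mkord.
by apply: eq_bigr => i _; rewrite coef_poly ltn_ord.
Qed.

Lemma rational_span_countable : countable rational_span.
Proof. by apply: card_le_trans (card_image_le _ _) _; exact: countableP. Qed.

Lemma rational_spanD d d' :
  rational_span d -> rational_span d' -> rational_span (d + d').
Proof.
move=> [p _ <-] [q _ <-]; exists (p + q) => //.
rewrite (rational_combination_widen (leq_maxl (size p) (size q))).
rewrite (rational_combination_widen (leq_maxr (size p) (size q))).
rewrite (rational_combination_widen (size_polyD p q)) -big_split.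
by apply: eq_bigr => i _; rewrite coefD raddfD scalerDl.
Qed.

Lemma rational_spanZ (c : rat) d : rational_span d -> rational_span (ratr c *: d).
Proof.
move=> [p _ <-]; exists (c *: p) => //.
rewrite (rational_combination_widen (size_scale_leq c p)) scaler_sumr.
by apply: eq_bigr => i _; rewrite coefZ rmorphM scalerA.
Qed.

End rational_span.

(** * The two random series *)

Lemma limf_esup_frequently (R : realType) (u : nat -> R) (T : set nat) :
  (0 < limf_esup (fun n => (u n)%:E) (within T \oo))%E ->
  exists2 delta : R, 0 < delta &
    forall m, exists n, [/\ (m <= n)%N, T n & delta < u n].
Proof.
move=> sup_gt0.
have [delta delta0 dsup] : exists2 delta : R, 0 < delta &
    (delta%:E < limf_esup (fun n => (u n)%:E) (within T \oo))%E.
  case: limf_esup sup_gt0 => [s|_|//].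
  - by rewrite lte_fin => s0; exists (s / 2); rewrite ?divr_gt0// lte_fin; lra.
  - by exists 1; rewrite ?ltry.
exists delta => // m.
have : (limf_esup (fun n => (u n)%:E) (within T \oo) <=
    ereal_sup [set (u n)%:E | n in [set n | T n /\ (m <= n)%N]])%E.
  apply: ereal_inf_lbound; exists [set n | T n /\ (m <= n)%N] => //.
  by exists m.
move=> /(lt_le_trans dsup) /ereal_sup_gt[_ [n [Tn mn] <-]].
by rewrite lte_fin => dn; exists n.
Qed.

(** Countably many balls of radius eta contain all tau-limits of series
    whose terms are rational multiples of the x n; the second part of
    admissibility is what makes this work in a nonseparable space. *)
Lemma series_near_countable (R : realType) (k : scalar_field)
    (X : normedModType (scalars R k)) (tau : Topological X)
    (tau_adm : admissible tau) (x : nat -> X) (eta : R) : 0 < eta ->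
  exists2 D : set X, countable D &
    forall (c : nat -> rat) (l : X),
      series (fun n => ratr (c n) *: x n) @ \oo --> (l : retop tau) ->
      exists2 d, D d & `|l - d| <= real_scalar k eta.
Proof.
move=> eta0.
have [[S cS dS]|nsep] := pselect (separable X).
  exists S => // c l _.
  have eta0' : 0 < real_scalar k eta by rewrite -(real_scalar0 R k) ltr_real_scalar.
  have [||d [/= ld Sd]] := dS (ball l (real_scalar k eta)).
  - by exists l; exact: ballxx.
  - exact: ball_open.
  by exists d => //; rewrite ltW//; move: ld; rewrite -ball_normE.
exists (rational_span x); first exact: rational_span_countable.
move=> c l cl.
have [d Dd ld] : exists2 d, rational_span x d & rnorm (l - d) < eta.
  apply: (weak_limit_near _ _ _ _ (admissible_stronger_than_weak tau_adm nsep) _ cl eta0).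
  - by exists (rational_combination x 0), 0.
  - exact: rational_spanD.
  - by move=> d /(rational_spanZ (-1)); rewrite rmorphN1 scaleN1r.
  - move=> n d Dd; exists (ratr n.+1%:R^-1 *: d); first exact: rational_spanZ.
    by rewrite -scaler_nat scalerA fmorphV rmorph_nat divff ?scale1r// pnatr_eq0.
  - by move=> N; exact: rational_span_poly.
by exists d => //; rewrite norm_rnorm ler_real_scalar ltW.
Qed.

(** Rational coefficients put the partial sums in the rational span of x, where
    countably many centres are available. *)
Lemma rational_random_series_null (R : realType) (k : scalar_field)
    (X : normedModType (scalars R k)) (tau : Topological X)
    (tau_adm : admissible tau) (x : nat -> X) (f : nat -> nat)
    (f_fin : forall n, finite_set (f @^-1` [set n])) (T : set nat)
    (limsup_gt0 :
      (0 < limf_esup (fun n => (rnorm (block x f n))%:E) (within T \oo))%E)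
    (P : probability cantor_borel R) (P_haar : is_haar P) (a : bool -> rat) :
  1 <= `|a true - a false| ->
  P.-negligible
    [set e | tau_summable tau (random_term x f T (fun b => ratr (a b)) e)].
Proof.
move=> a_gap.
have [delta delta0 blocks] := limf_esup_frequently limsup_gt0.
have [D cD Dnear] := series_near_countable tau_adm x (divr_gt0 delta0 (ltr0n _ 2)).
have half : real_scalar k (delta / 2) = real_scalar k delta / 2.
  by rewrite [in RHS](splitr delta) real_scalarD; field.
apply: (random_series_null P_haar tau_adm f_fin _ _ _ cD (delta := real_scalar k delta)).
- by rewrite -(real_scalar0 R k) ltr_real_scalar.
- move=> m; have [n [mn Tn dn]] := blocks m; exists n; split=> //.
  by rewrite norm_rnorm ltr_real_scalar.
- by rewrite -rmorphB -ratr_norm -(rmorph1 (@ratr (scalars R k))) ler_rat.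
- move=> e l; rewrite -half.
  have -> : random_term x f T (fun b => ratr (a b)) e =
      (fun n => ratr (if n \in f @^-1` T then a (e (f n)) else 0) *: x n).
    apply/funext => n; rewrite /random_term /patch.
    by case: ifP; rewrite ?rmorph0 ?scale0r.
  exact: Dnear.
Qed.

Theorem theorem1p2 (R : realType) (k : scalar_field)
    (X : completeNormedModType (scalars R k))
    (tau : Topological X) (tau_adm : admissible tau)
    (x : nat -> X) (f : nat -> nat)
    (f_fin : forall n, finite_set (f @^-1` [set n]))
    (T : set nat) (T_inf : infinite_set T)
    (limsup_gt0 :
      (0 < limf_esup
             (fun n => (rnorm (\sum_(m \in f @^-1` [set n]) x m))%:E)
             (within T \oo))%E)
    (P : probability cantor_borel R) (P_haar : is_haar P) :
  {ae P, forall e : cantor_borel,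
    ~ tau_summable tau
        (patch (fun=> 0) (f @^-1` T)
           (fun n => cantor_sign (scalars R k) e (f n) *: x n)) /\
    ~ tau_summable tau
        (patch (fun=> 0) (f @^-1` T)
           (fun n => (2^-1 * (1 - cantor_sign (scalars R k) e (f n))) *: x n))}.
Proof.
have sign_ratr (b : bool) : ((-1) ^+ b : scalars R k) = ratr ((-1) ^+ b).
  by rewrite rmorph_sign.
have null1 := rational_random_series_null tau_adm f_fin limsup_gt0 P_haar
  (a := fun b : bool => (-1) ^+ b) isT.
have null2 := rational_random_series_null tau_adm f_fin limsup_gt0 P_haar
  (a := fun b : bool => 2^-1 * (1 - (-1) ^+ b)) isT.
apply: negligibleS (negligibleU null1 null2) => e.
move=> /not_andP[/contrapT sum1|/contrapT sum2]; [left|right] => /=.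
  move: sum1; congr (tau_summable _ _); apply/funext => n.
  by rewrite /random_term /patch; case: ifP => // _; rewrite -sign_ratr.
move: sum2; congr (tau_summable _ _); apply/funext => n.
rewrite /random_term /patch; case: ifP => // _.
by rewrite rmorphM rmorphB rmorph1 rmorph_sign fmorphV rmorph_nat.
Qed.
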